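(* For $q,y\ge0$ let $$M(q,y):=\max\bigl(q,\ 1+\theta y,\ q+\theta(1+y-2q)\bigr).$$ Consider the following conditions on a map $E:\mathbb{R}_+^2\to\mathbb{R}_+$: $$\begin{aligned}\text{(a)}\quad&E(q,z)\le E(q,y)\le E(q,z)+\theta(y-z)&&\text{for }0\le z\le y,\\ \text{(b)}\quad&E(q,y)\le\max\bigl(E(1+y-q,y),\,q,\,1,\,1+y-q\bigr)&&\text{for }0\le q\le y+1,\\ \text{(c)}\quad&E(q,y)\le\max(q,1)&&\text{for }y\le\max(0,q-1).\end{aligned}$$ Then the map $M$ satisfies (a)–(c). Moreover, any map $E:\mathbb{R}_+^2\to\mathbb{R}_+$ that satisfies (a)–(c) also satisfies $E(q,y)\le M(q,y)$ for all $q,y\ge0$.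
   Context: $\mathbb{R}_+=[0,\infty)$. $\theta=\sup_{q\in\mathbb{N}}\theta_q$ with $\theta_q=\sqrt{\max(0,1-4\lambda_1(q))}$, where $\lambda_1(q)$ is the smallest positive eigenvalue of the hyperbolic Laplacian for $\Gamma_0(q)$; it is known that $0\le\theta\le7/32<1/2$. *)

(* Defs.v *)
From HB Require Import structures.
From mathcomp Require Import all_boot all_order all_algebra complex.
From mathcomp Require Import all_classical all_reals all_analysis.
Set Implicit Arguments.
Unset Strict Implicit.
Unset Printing Implicit Defensive.
Import Order.TTheory GRing.Theory Num.Theory.
Import numFieldNormedType.Exports.
Local Open Scope classical_set_scope.
Local Open Scope ring_scope.

(* Points of the plane are pairs (x, y), which carry the normed and measurable
   structures; [to_C] passes to x + iy, where SL_2(Z) acts. *)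
Definition to_C (R : realType) (p : R * R) : R[i] := Complex p.1 p.2.

Definition upper_half_plane (R : realType) : set (R * R) := [set p | 0 < p.2].

Definition in_SL2Z (g : 'M[int]_2) : Prop := \det g = 1.

Definition in_Gamma0 (q : nat) (g : 'M[int]_2) : Prop :=
  in_SL2Z g /\ (q%:Z %| g 1%R 0%R)%Z.

Definition moebius (R : realType) (g : 'M[int]_2) (z : R[i]) : R[i] :=
  ((g 0 0)%:~R * z + (g 0 1)%:~R) / ((g 1 0)%:~R * z + (g 1 1)%:~R).

Fixpoint Ck_on (R : realType) (k : nat) (U : set (R * R)) (u : R * R -> R)
    : Prop :=
  (forall p, U p -> {for p, continuous u}) /\
  match k with
  | 0%N => True
  | k'.+1 => forall v : R * R,
      (forall p, U p -> derivable u p v) /\ Ck_on k' U ('D_v u)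
  end.

Definition smooth_on (R : realType) (U : set (R * R)) (u : R * R -> R) : Prop :=
  forall k, Ck_on k U u.

Definition re_part (R : realType) (f : R[i] -> R[i]) (p : R * R) : R :=
  complex.Re (f (to_C p)).

Definition im_part (R : realType) (f : R[i] -> R[i]) (p : R * R) : R :=
  complex.Im (f (to_C p)).

Definition hyp_laplacian (R : realType) (u : R * R -> R) (p : R * R) : R :=
  - p.2 ^+ 2 * ('D_(1, 0) ('D_(1, 0) u) p + 'D_(0, 1) ('D_(0, 1) u) p).

(* The standard fundamental domain of SL_2(Z), up to a null set. *)
Definition fund_dom (R : realType) : set (R * R) :=
  [set p | [/\ 0 < p.2, `|p.1| <= 2^-1 & 1 <= p.1 ^+ 2 + p.2 ^+ 2]].

(* A fundamental domain of Gamma_0(q) is the union of the translates of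
   [fund_dom] by finitely many coset representatives g, and dx dy / y^2 is
   invariant.  So, for an f invariant under Gamma_0(q), being square-integrable
   on Gamma_0(q) \ H means that each |f o g|^2 is integrable on [fund_dom]. *)
Definition square_integrable (R : realType) (f : R[i] -> R[i]) : Prop :=
  forall g : 'M[int]_2, in_SL2Z g ->
    (\int[(@lebesgue_measure R \x @lebesgue_measure R)%E]_(p in @fund_dom R)
       (ComplexField.Normc.normc (f (moebius g (to_C p))) ^+ 2 / p.2 ^+ 2)%:E < +oo)%E.

Definition is_eigenfunction (R : realType) (q : nat) (lambda : R)
    (f : R[i] -> R[i]) : Prop :=
  let H := @upper_half_plane R in
  [/\ exists2 p, H p & f (to_C p) != 0,
      forall g, in_Gamma0 q g ->
        forall p, H p -> f (moebius g (to_C p)) = f (to_C p),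
      square_integrable f,
      smooth_on H (re_part f) /\ smooth_on H (im_part f) &
      forall p, H p ->
        hyp_laplacian (re_part f) p = lambda * re_part f p /\
        hyp_laplacian (im_part f) p = lambda * im_part f p].

Definition is_eigenvalue (R : realType) (q : nat) (lambda : R) : Prop :=
  exists f, is_eigenfunction q lambda f.

(* The infimum is a minimum: Gamma_0(q) has positive eigenvalues, and they are
   real with no finite accumulation point. *)
Definition lambda1 (R : realType) (q : nat) : R :=
  inf [set lambda | 0 < lambda /\ is_eigenvalue q lambda].

Definition theta_level (R : realType) (q : nat) : R :=
  Num.sqrt (Num.max 0 (1 - 4 * lambda1 R q)).

Definition theta (R : realType) : R :=
  sup [set theta_level R q | q in [set q : nat | (0 < q)%N]].

Definition M (R : realType) (q y : R) : R :=
  Num.max q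
    (Num.max (1 + theta R * y) (q + theta R * (1 + y - 2 * q))).

(* Maps from R_+^2 to R_+ are represented by functions on R^2 which are only
   constrained, and only compared, at nonnegative arguments. *)
Definition maps_nonneg (R : realType) (E : R -> R -> R) : Prop :=
  forall q y, 0 <= q -> 0 <= y -> 0 <= E q y.

Definition cond_a (R : realType) (E : R -> R -> R) : Prop :=
  forall q y z, 0 <= q -> 0 <= z -> z <= y ->
    E q z <= E q y /\ E q y <= E q z + theta R * (y - z).

Definition cond_b (R : realType) (E : R -> R -> R) : Prop :=
  forall q y, 0 <= q -> 0 <= y -> q <= y + 1 ->
    E q y <= Num.max (E (1 + y - q) y) (Num.max q (Num.max 1 (1 + y - q))).

Definition cond_c (R : realType) (E : R -> R -> R) : Prop :=
  forall q y, 0 <= q -> 0 <= y -> y <= Num.max 0 (q - 1) ->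
    E q y <= Num.max q 1.

(* Main.v *)
Require Import Defs.
From HB Require Import structures.
From mathcomp Require Import all_boot all_order all_algebra complex.
From mathcomp Require Import all_classical all_reals all_analysis.
From mathcomp Require Import lra.
Set Implicit Arguments.
Unset Strict Implicit.
Unset Printing Implicit Defensive.
Import Order.TTheory GRing.Theory Num.Theory.
Local Open Scope ring_scope.

(** Write t for theta and q' = 1 + y - q for the reflection of q in (b), so
    that 1 + y - 2q = q' - q.  That [M] satisfies (a)-(c) is elementary; the
    point in (b) is that q + t(q' - q) lies between q and q'.

    For maximality, on the line y = 2q - 1 (where q = q') the third term of
    [M] equals q.  So if E <= max(q, 1 + ty) held below this line, the
    Lipschitz bound in (a), used upwards from it, would give E <= M above it
    ([lipschitz_extend]).  This is reached by approximation.  For q <= 1 the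
    bound 1 + ty is immediate ([le_small_q]); for q > 1, condition (c)
    gives the bound on the lower line y = q - 1, hence above it
    E <= max(q, 1 + ty, q + t(1 + y - 2q) + e t q) with e = 1
    ([le_relaxed_M1]).  If such a bound holds for some e, then inserting it at
    (q', y) into (b) proves E <= max(q, 1 + ty) up to the line
    y = (2 - e/2)q - 1: there the loss e t q' is absorbed by the gain
    (1 - t)(q - q'), since t <= 1/3.  Extending upwards from this line, by the
    Lipschitz bound, gives the bound with e/2 in place of e
    ([le_relaxed_M_half]).  Letting e tend to 0 yields E <= M. *)

(** Holds whether or not the set of the theta_q is bounded, since [sup] is 0 on
    a set without supremum. *)
Lemma theta_ge0 (R : realType) : 0 <= theta R.
Proof.
rewrite /theta; set A := (X in sup X).
have [supA|/sup_out -> //] := pselect (has_sup A).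
have A1 : A (theta_level R 1) by exists 1%N.
exact: le_trans (sqrtr_ge0 _) (sup_upper_bound supA A1).
Qed.

Section MIsAdmissible.
Variable R : realType.
Let t := theta R.

Lemma M_nonneg : maps_nonneg (@M R).
Proof. by move=> q y q0 _; rewrite le_max q0. Qed.

Lemma M_cond_a : cond_a (@M R).
Proof.
have t0 : 0 <= t := theta_ge0 R.
move=> q y z q0 z0 zy; rewrite /M -/t.
have tyz : 0 <= t * (y - z) by rewrite mulr_ge0 // subr_ge0.
split.
  rewrite !ge_max !le_max lexx /=.
  by apply/andP; split; apply/orP; right; apply/orP; [left|right]; lra.
rewrite !ge_max -!lerBlDr !le_max.
apply/and3P; split; [apply/orP; left | apply/orP; right; apply/orP; left |
  apply/orP; right; apply/orP; right]; lra.
Qed.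

Lemma M_cond_b : t <= 1 -> cond_b (@M R).
Proof.
have t0 : 0 <= t := theta_ge0 R.
move=> t1 q y q0 y0 qy; rewrite /M -/t !ge_max !le_max !lexx !orbT /=.
case: (lerP (1 + y - 2 * q) 0) => h.
  have : 0 <= t * - (1 + y - 2 * q) by rewrite mulr_ge0 // oppr_ge0.
  by move=> ?; apply/orP; right; apply/orP; left; lra.
have : 0 <= (1 - t) * (1 + y - 2 * q) by apply: mulr_ge0; lra.
by move=> ?; do 3 (apply/orP; right); lra.
Qed.

Lemma M_cond_c : t <= 1 / 2 -> cond_c (@M R).
Proof.
have t0 : 0 <= t := theta_ge0 R.
move=> t12 q y q0 y0; rewrite le_max => yq.
rewrite /M -/t !ge_max !le_max lexx /=.
case/orP: yq => hy.
  have -> : y = 0 by apply/eqP; rewrite eq_le hy.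
  apply/andP; split; first by apply/orP; right; lra.
  case: (lerP (1 - 2 * q) 0) => h; apply/orP; [left|right].
    have : 0 <= t * - (1 - 2 * q) by apply: mulr_ge0; lra.
    lra.
  have : 0 <= (1 / 2 - t) * (1 - 2 * q) by apply: mulr_ge0; lra.
  lra.
apply/andP; split; apply/orP; left.
  have : 0 <= (1 - t) * y by apply: mulr_ge0; lra.
  lra.
have : 0 <= t * - (1 + y - 2 * q) by apply: mulr_ge0; lra.
lra.
Qed.

End MIsAdmissible.

Section Maximality.
Variables (R : realType) (E : R -> R -> R).
Let t := theta R.
Hypotheses (Ea : cond_a E) (Eb : cond_b E) (Ec : cond_c E).

(** The error is put into the third term only and is proportional to q, since
    these are the features that one use of (b) reproduces with e/2 for e. *)
Definition relaxed_M (e q y : R) : R :=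
  Num.max q (Num.max (1 + t * y) (q + t * (1 + y - 2 * q) + e * t * q)).

(** Turns the bound max(q, 1 + tz) on a line y = z(q) into one above it: the
    term 1 + tz has exactly the slope allowed by (a), so only q gains a term. *)
Lemma lipschitz_extend q y z : 0 <= q -> 0 <= z -> z <= y ->
  E q z <= Num.max q (1 + t * z) ->
  E q y <= Num.max (1 + t * y) (q + t * (y - z)).
Proof.
have t0 : 0 <= t := theta_ge0 R.
move=> q0 z0 zy; have [_] := Ea q0 z0 zy; rewrite -/t => EqyE.
by rewrite !le_max => /orP[h|h]; apply/orP; [right|left]; lra.
Qed.

(** For q <= 1 condition (c) says nothing beyond y = 0, but the Lipschitz bound
    from there is already sharp. *)
Lemma le_small_q q y : 0 <= q -> q <= 1 -> 0 <= y -> E q y <= 1 + t * y.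
Proof.
have t0 : 0 <= t := theta_ge0 R.
move=> q0 q1 y0; have [_] := Ea q0 (lexx 0) y0.
have := Ec q0 (lexx 0); rewrite le_max lexx => /(_ isT).
by rewrite (max_idPr q1) -/t => ? ?; lra.
Qed.

Lemma le_below q y : 1 <= q -> 0 <= y -> y <= q - 1 -> E q y <= q.
Proof.
move=> q1 y0 yq; have q0 : 0 <= q by lra.
by have := Ec q0 y0; rewrite le_max yq orbT (max_idPl q1); apply.
Qed.

Lemma le_relaxed_M1 q y : 0 <= q -> 0 <= y -> E q y <= relaxed_M 1 q y.
Proof.
have t0 : 0 <= t := theta_ge0 R.
move=> q0 y0; rewrite /relaxed_M.
case: (lerP q 1) => q1; first by rewrite !le_max le_small_q ?orbT.
case: (lerP y (q - 1)) => yq; first by rewrite le_max le_below // ltW.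
have z0 : 0 <= q - 1 by lra.
have Ez : E q (q - 1) <= Num.max q (1 + t * (q - 1)).
  by rewrite le_max le_below // ltW.
apply: (le_trans (lipschitz_extend q0 z0 (ltW yq) Ez)).
rewrite ge_max !le_max lexx orbT /=; do 2 (apply/orP; right); nra.
Qed.

(** The point of (b): reflection sends q to some q' <= q, at a distance which
    pays for the error term e t q' of the given bound. *)
Lemma reflection_step e q y : t <= 1 / 3 -> 0 <= e ->
  (forall p, 0 <= p -> E p y <= relaxed_M e p y) ->
  1 <= q -> 0 <= y -> q <= y + 1 -> y <= (2 - e / 2) * q - 1 ->
  E q y <= Num.max q (1 + t * y).
Proof.
have t0 : 0 <= t := theta_ge0 R.
move=> t13 e0 IH q1 y0 qy yz; have q0 : 0 <= q by lra.
set p := 1 + y - q; have p0 : 0 <= p by rewrite /p; lra.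
have gap : e / 2 * q <= q - p by rewrite /p; lra.
have eq0 : 0 <= e * q by rewrite mulr_ge0.
have pq : p <= q by lra.
(* [gap] gives e p <= e q <= 2 (q - p), so the claim costs 3t <= 1. *)
have absorbed : p + t * (1 + y - 2 * p) + e * t * p <= q.
  have -> : 1 + y - 2 * p = q - p by rewrite /p; lra.
  have ep : e * p <= e * q by rewrite ler_wpM2l.
  have : t * (e * p) <= t * (2 * (q - p)) by rewrite ler_wpM2l //; lra.
  have : 0 <= (1 - 3 * t) * (q - p) by rewrite mulr_ge0 // subr_ge0; lra.
  lra.
apply: (le_trans (Eb q0 y0 qy)); rewrite -/p !ge_max !le_max lexx q1 pq !andbT.
have := IH p p0; rewrite !le_max => /or3P[h|h|h]; apply/orP; [left|right|left].
- exact: le_trans pq.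
- exact: h.
- exact: le_trans absorbed.
Qed.

Lemma le_relaxed_M_half e : t <= 1 / 3 -> 0 <= e -> e <= 1 ->
  (forall q y, 0 <= q -> 0 <= y -> E q y <= relaxed_M e q y) ->
  forall q y, 0 <= q -> 0 <= y -> E q y <= relaxed_M (e / 2) q y.
Proof.
have t0 : 0 <= t := theta_ge0 R.
move=> t13 e0 e1 IH q y q0 y0; rewrite /relaxed_M.
case: (lerP q 1) => q1; first by rewrite !le_max le_small_q ?orbT.
case: (lerP y (q - 1)) => yq; first by rewrite le_max le_below // ltW.
(* At y = z the third term of the bound with e/2 in place of e equals q. *)
pose z := (2 - e / 2) * q - 1.
have zq : q <= z + 1 by rewrite /z; nra.
have z0 : 0 <= z by lra.
have below x : 0 <= x -> q <= x + 1 -> x <= z -> E q x <= Num.max q (1 + t * x).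
  move=> x0 qx xz; apply: (reflection_step t13 e0) => //; last exact: ltW.
  by move=> p p0; apply: IH.
case: (lerP y z) => yz.
  apply: (le_trans (below y y0 _ yz)); first by lra.
  by rewrite ge_max !le_max !lexx orbT.
apply: (le_trans (lipschitz_extend q0 z0 (ltW yz) (below z z0 zq (lexx z)))).
rewrite ge_max !le_max lexx orbT /=; do 2 (apply/orP; right); rewrite /z; lra.
Qed.

Lemma le_relaxed_M_pow n : t <= 1 / 3 ->
  forall q y, 0 <= q -> 0 <= y -> E q y <= relaxed_M (2^-1 ^+ n) q y.
Proof.
move=> t13; elim: n => [|n IH]; first exact: le_relaxed_M1.
rewrite exprSr; apply: le_relaxed_M_half => //.
by rewrite exprn_ile1 // invf_le1 // ler1n.
Qed.

Lemma relaxed_M_le e q y : 0 <= e -> 0 <= q ->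
  relaxed_M e q y <= M q y + e * (t * q).
Proof.
have t0 : 0 <= t := theta_ge0 R.
move=> e0 q0; have etq : 0 <= e * (t * q) by rewrite !mulr_ge0.
rewrite !ge_max -!lerBlDr !le_max -/t.
apply/and3P; split; [apply/orP; left | apply/orP; right; apply/orP; left |
  apply/orP; right; apply/orP; right]; lra.
Qed.

Lemma admissible_le_M : t <= 1 / 3 ->
  forall q y, 0 <= q -> 0 <= y -> E q y <= M q y.
Proof.
have t0 : 0 <= t := theta_ge0 R.
move=> t13 q y q0 y0; apply/ler_addgt0Pr => d d0.
have tq0 : 0 <= t * q by rewrite mulr_ge0.
have [n tqn] : exists n, t * q / d < n%:R.
  by exists (Num.truncn (t * q / d)).+1; apply: truncnS_gt.
apply: (le_trans (le_relaxed_M_pow n t13 q0 y0)).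
have e0 : 0 <= (2^-1 ^+ n : R) by rewrite exprn_ge0.
apply: (le_trans (relaxed_M_le y e0 q0)).
rewrite lerD2l exprVn mulrC ler_pdivrMr ?exprn_gt0 // [d * _]mulrC -ler_pdivrMr //.
by rewrite (le_trans (ltW tqn)) // -natrX ler_nat ltnW // ltn_expl.
Qed.

End Maximality.

Theorem propositionA1 (R : realType) (theta_le : theta R <= 7 / 32) :
  [/\ maps_nonneg (@M R), cond_a (@M R), cond_b (@M R) & cond_c (@M R)] /\
  (forall E : R -> R -> R,
     maps_nonneg E -> cond_a E -> cond_b E -> cond_c E ->
     forall q y : R, 0 <= q -> 0 <= y -> E q y <= M q y).
Proof.
split.
  split; [exact: M_nonneg | exact: M_cond_a | |].
  - by apply: M_cond_b; lra.
  - by apply: M_cond_c; lra.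
by move=> E _ Ea Eb Ec; apply: admissible_le_M => //; lra.
Qed.
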